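(* Let $\alpha\in(0,1)$ and let $\psi:\mathbb{R}\times\mathbb{R}\to\mathbb{R}$ be given by $$\psi(x,t):=\begin{cases}\alpha & \text{if } x>t,\\ 0 & \text{if } x=t,\\ \alpha-1 & \text{if } x<t.\end{cases}$$ Then, for each integer $n\geq 2$, the function $\psi$ has the property $[T_n]$ (with $X=\Theta=\mathbb{R}$) if and only if $\alpha\notin\big\{\frac{1}{n},\dots,\frac{n-1}{n}\big\}$. Further, in this case, for all $x_1,\dots,x_n\in\mathbb{R}$, we have that $$\vartheta_n(x_1,\ldots,x_n)=x^*_{\lceil n\alpha\rceil}=x^*_{\lfloor n\alpha+1\rfloor},$$ and hence also $\vartheta_n(x_1,\ldots,x_n)=\frac12\big(x^*_{\lceil n\alpha\rceil}+x^*_{\lfloor n\alpha+1\rfloor}\big)$, where $x_1^*\leq x_2^*\leq\cdots\leq x_n^*$ denotes the ordered sample of $x_1,\ldots,x_n$.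
   Context: $\lceil\cdot\rceil$ and $\lfloor\cdot\rfloor$ denote the upper and lower integer parts. A function $\psi:\mathbb{R}\times\mathbb{R}\to\mathbb{R}$ such that for each $x\in\mathbb{R}$ there are $t_+<t_-$ in $\mathbb{R}$ with $\psi(x,t_+)>0>\psi(x,t_-)$ has the property $[T_n]$ if for every $(x_1,\ldots,x_n)\in\mathbb{R}^n$ there exists a (necessarily unique) number $\vartheta_n(x_1,\ldots,x_n)\in\mathbb{R}$ such that $\sum_{i=1}^n\psi(x_i,t)>0$ for all $t<\vartheta_n(x_1,\ldots,x_n)$ and $\sum_{i=1}^n\psi(x_i,t)<0$ for all $t>\vartheta_n(x_1,\ldots,x_n)$. *)

(* Defs.v *)
From mathcomp Require Import all_boot all_order all_algebra.
From mathcomp Require Import all_classical all_reals.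
Import Order.TTheory GRing.Theory Num.Theory.

Set Implicit Arguments.
Unset Strict Implicit.
Unset Printing Implicit Defensive.

Local Open Scope ring_scope.

Definition sign_changing (R : realType) (psi : R -> R -> R) : Prop :=
  forall x : R, exists tp tm : R,
    [/\ tp < tm, 0 < psi x tp & psi x tm < 0].

Definition is_vartheta (R : realType) (psi : R -> R -> R) (n : nat)
    (x : n.-tuple R) (theta : R) : Prop :=
  (forall t : R, t < theta -> 0 < \sum_(i < n) psi (tnth x i) t) /\
  (forall t : R, theta < t -> \sum_(i < n) psi (tnth x i) t < 0).

Lemma is_vartheta_unique (R : realType) (psi : R -> R -> R) (n : nat)
    (x : n.-tuple R) (u v : R) :
  is_vartheta psi x u -> is_vartheta psi x v -> u = v.
Proof.
have lt_false (a b : R) : is_vartheta psi x a -> is_vartheta psi x b ->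
    a < b -> False.
  move=> [_ ha] [hb _] ab.
  have := lt_trans (hb _ (midf_lt ab).2) (ha _ (midf_lt ab).1).
  by rewrite ltxx.
move=> hu hv; case: (ltgtP u v) => // [uv|vu].
  by case: (lt_false _ _ hu hv uv).
by case: (lt_false _ _ hv hu vu).
Qed.

Definition has_T (R : realType) (psi : R -> R -> R) (n : nat) : Prop :=
  sign_changing psi /\
  forall x : n.-tuple R, exists theta : R, is_vartheta psi x theta.

(* The default value 0 is only returned when no such point exists; by
   [is_vartheta_unique] the choice is otherwise forced. *)
Definition vartheta (R : realType) (psi : R -> R -> R) (n : nat)
    (x : n.-tuple R) : R :=
  xget 0 [set theta | is_vartheta psi x theta]%classic.

Definition quantile_psi (R : realType) (alpha x t : R) : R :=
  if t < x then alpha else if x == t then 0 else alpha - 1.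

(* The k-th smallest entry of x. The index k is 1-based, as in x*_1 <= ... <=
   x*_n, and an integer so that floors and ceilings apply directly; only
   1 <= k <= n is meaningful. *)
Definition order_stat (R : realType) (n : nat) (x : n.-tuple R) (k : int) : R :=
  nth 0 (sort <=%R x) `|k - 1|%N.

(* Main.v *)
Require Import Defs.
From mathcomp Require Import all_boot all_order all_algebra.
From mathcomp Require Import all_classical all_reals.
From mathcomp Require Import lra.
Import Order.TTheory GRing.Theory Num.Theory.
Local Open Scope ring_scope.

(** Let s be the ordered sample, indexed from 0. Each entry above t contributes
    alpha to the sum of the psi(x_i, t) and each entry below t contributes
    alpha - 1, so the sum equals n * alpha minus the number of entries below t,
    up to the entries tied with t. Hence the sum is at least n * alpha - k to
    the left of s_k ([sum_quantile_psi_ge]) and at most n * alpha - (k + 1) to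
    its right ([sum_quantile_psi_le]).

    If k/n < alpha < (k+1)/n, the first bound is positive and the second is
    negative, so s_k, the order statistic of rank k + 1, is the point of sign
    change. The rank k + 1 is both the ceiling of n * alpha and the floor of
    n * alpha + 1.

    If alpha = k/n with 0 < k < n, take the sample of k zeros and n - k ones.
    On the open interval (0, 1) the left bound at s_k and the right bound at
    s_(k-1) are both 0, so the sum vanishes on a nondegenerate interval and no
    point of sign change exists. *)

Section QuantilePsi.
Variables (R : realType) (alpha : R).
Hypotheses (halpha0 : 0 < alpha) (halpha1 : alpha < 1).
Implicit Types (s : seq R) (t y : R) (k n : nat).

Lemma quantile_psi_gt y t : t < y -> quantile_psi alpha y t = alpha.
Proof. by rewrite /quantile_psi => ->. Qed.

Lemma quantile_psi_lt y t : y < t -> quantile_psi alpha y t = alpha - 1.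
Proof. by move=> yt; rewrite /quantile_psi ltNge (ltW yt) /= lt_eqF. Qed.

Lemma quantile_psi_bounds y t :
  alpha - 1 <= quantile_psi alpha y t <= alpha.
Proof.
by rewrite /quantile_psi; do 2?case: ifP => _;
  apply/andP; split; move: halpha0 halpha1; lra.
Qed.

Lemma sign_changing_quantile_psi : sign_changing (quantile_psi alpha).
Proof.
move=> x; exists (x - 1), (x + 1); split; first by lra.
  by rewrite quantile_psi_gt //; lra.
by rewrite quantile_psi_lt; move: halpha1; lra.
Qed.

(** The entries from index k on lie above t and contribute exactly alpha; the k
    earlier ones contribute at least alpha - 1 each. *)
Lemma sum_quantile_psi_ge s k t : sorted <=%R s -> (k < size s)%N ->
  t < s`_k -> (size s)%:R * alpha - k%:R <= \sum_(y <- s) quantile_psi alpha y t.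
Proof.
move=> s_sorted ks tk; rewrite (big_nth 0) (big_cat_nat _ (n := k)) ?(ltnW ks) //=.
have -> : (size s)%:R * alpha - k%:R =
    \sum_(0 <= i < k) (alpha - 1) + \sum_(k <= i < size s) alpha.
  rewrite !sumr_const_nat subn0 -(mulr_natl (alpha - 1)) -(mulr_natl alpha).
  by rewrite (natrB _ (ltnW ks)); lra.
apply: lerD; first by apply: ler_sum => i _; case/andP: (quantile_psi_bounds s`_i t).
apply: ler_sum_nat => i /andP[ki iss].
rewrite quantile_psi_gt //; apply: (lt_le_trans tk).
by apply: (sorted_leq_nth le_trans lexx).
Qed.

Lemma sum_quantile_psi_le s k t : sorted <=%R s -> (k < size s)%N ->
  s`_k < t -> \sum_(y <- s) quantile_psi alpha y t <= (size s)%:R * alpha - k.+1%:R.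
Proof.
move=> s_sorted ks tk; rewrite (big_nth 0) (big_cat_nat _ (n := k.+1)) //=.
have -> : (size s)%:R * alpha - k.+1%:R =
    \sum_(0 <= i < k.+1) (alpha - 1) + \sum_(k.+1 <= i < size s) alpha.
  rewrite !sumr_const_nat subn0 -(mulr_natl (alpha - 1)) -(mulr_natl alpha).
  by rewrite (natrB _ ks); lra.
apply: lerD; last by apply: ler_sum => i _; case/andP: (quantile_psi_bounds s`_i t).
apply: ler_sum_nat => i /andP[_ ik].
rewrite quantile_psi_lt //; apply: le_lt_trans tk.
by apply: (sorted_leq_nth le_trans lexx) => //; rewrite inE (leq_trans ik).
Qed.

Lemma is_vartheta_nth_sort n (x : n.-tuple R) k :
  k%:R < n%:R * alpha < k.+1%:R ->
  is_vartheta (quantile_psi alpha) x (sort <=%R x)`_k.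
Proof.
move=> /andP[kn nk].
have ssz : size (sort <=%R x) = n by rewrite size_sort size_tuple.
have sumE t : \sum_(i < n) quantile_psi alpha (tnth x i) t =
    \sum_(y <- sort <=%R x) quantile_psi alpha y t.
  rewrite -(big_tuple _ _ x predT (fun y => quantile_psi alpha y t)).
  by apply: perm_big; rewrite perm_sym perm_sort.
have klt : (k < n)%N.
  rewrite -(ltr_nat R); apply: (lt_le_trans kn).
  by rewrite ler_piMr ?ler0n // ltW.
have s_sorted := sort_le_sorted x.
split=> t tk; rewrite sumE.
  by have := sum_quantile_psi_ge _ k t s_sorted; rewrite ssz => /(_ klt tk); lra.
by have := sum_quantile_psi_le _ k t s_sorted; rewrite ssz => /(_ klt tk); lra.
Qed.

(** On the sample of k zeros and n - k ones the sum vanishes throughout (0, 1),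
    so every point of (0, 1) would have to be the point of sign change. *)
Lemma natdiv_not_has_T n k : (0 < k < n)%N -> n%:R * alpha = k%:R ->
  ~ has_T (quantile_psi alpha) n.
Proof.
move=> /andP[k0 kn] nak [_ hT].
pose s : seq R := nseq k 0 ++ nseq (n - k) 1.
have ssz : size s == n by rewrite size_cat !size_nseq subnKC // ltnW.
have s_sorted : sorted <=%R s.
  rewrite sorted_pairwise; last exact: le_trans.
  rewrite pairwise_cat -!sorted_pairwise; try exact: le_trans.
  apply/and3P; split.
  - by apply/allrelP => a b /nseqP[-> _] /nseqP[-> _].
  - by apply/(sortedP 0) => i; rewrite size_nseq => ik; rewrite !nth_nseq !if_same.
  apply/(sortedP 0) => i; rewrite size_nseq => ik.
  by rewrite !nth_nseq ik (ltn_trans _ ik).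
have sum0 t : 0 < t < 1 ->
    \sum_(i < n) quantile_psi alpha (tnth (Tuple ssz) i) t = 0.
  move=> /andP[t0 t1].
  rewrite -(big_tuple _ _ (Tuple ssz) predT (fun y => quantile_psi alpha y t)) /=.
  have sk : s`_k = 1 by rewrite nth_cat size_nseq ltnn subnn nth_nseq subn_gt0 kn.
  have sk1 : s`_k.-1 = 0.
    by rewrite nth_cat size_nseq ltn_predL k0 nth_nseq if_same.
  apply/eqP; rewrite eq_le; apply/andP; split.
    have := sum_quantile_psi_le s k.-1 t s_sorted.
    rewrite sk1 (eqP ssz) (prednK k0) nak subrr; apply => //.
    exact: leq_trans (ltnW kn).
  have := sum_quantile_psi_ge s k t s_sorted.
  by rewrite sk (eqP ssz) nak subrr; apply.
have [theta [hlt hgt]] := hT (Tuple ssz).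
have forced t : 0 < t < 1 -> t = theta.
  move=> t01; case: (ltgtP t theta) => // [/hlt|/hgt]; rewrite sum0 // ltxx //.
(* Any two distinct points of (0, 1) give the contradiction. *)
have h3 : (3^-1 : R) = theta by apply: forced; lra.
have h2 : (2^-1 : R) = theta by apply: forced; lra.
by move: h3; rewrite -h2; lra.
Qed.

(** Since 0 < n * alpha < n, the fractions k/n with 0 < k < n are the only ways
    for n * alpha to be an integer. *)
Lemma natdivs_notin_between n : (0 < n)%N ->
  alpha \notin [seq k%:R / n%:R | k <- index_iota 1 n] ->
  exists k : nat, k%:R < n%:R * alpha < k.+1%:R.
Proof.
move=> n0 hnot; exists (Num.truncn (n%:R * alpha)).
have na0 : 0 <= n%:R * alpha by rewrite mulr_ge0 // ltW.
have /andP[le_na ->] := truncn_itv na0; rewrite andbT lt_neqAle le_na andbT.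
set k := Num.truncn _ in le_na *.
have n0R : (n%:R : R) != 0 by rewrite pnatr_eq0 -lt0n.
apply: contra hnot => /eqP kE; apply/mapP; exists k; last by rewrite kE mulrC mulKf.
rewrite mem_index_iota -!(ltr_nat R) kE mulr_gt0 ?ltr0n //=.
by rewrite gtr_pMr ?ltr0n.
Qed.

End QuantilePsi.

Theorem proposition4p3 (R : realType) (alpha : R)
    (halpha0 : 0 < alpha) (halpha1 : alpha < 1) (n : nat) (hn : (2 <= n)%N) :
  (has_T (quantile_psi alpha) n <->
     alpha \notin [seq k%:R / n%:R | k <- index_iota 1 n]) /\
  (alpha \notin [seq k%:R / n%:R | k <- index_iota 1 n] ->
   forall x : n.-tuple R,
     [/\ vartheta (quantile_psi alpha) x
           = order_stat x (Num.ceil (n%:R * alpha)),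
         order_stat x (Num.ceil (n%:R * alpha))
           = order_stat x (Num.floor (n%:R * alpha + 1))
       & vartheta (quantile_psi alpha) x
           = 2^-1 * (order_stat x (Num.ceil (n%:R * alpha))
                     + order_stat x (Num.floor (n%:R * alpha + 1)))]).
Proof.
have n0 : (0 < n)%N := ltnW hn.
split; first split.
- move=> hT; apply/negP => /mapP[k]; rewrite mem_index_iota => kn alphaE.
  apply: (natdiv_not_has_T _ _ halpha0 halpha1 _ _ kn) hT.
  by rewrite alphaE mulrC divfK // pnatr_eq0 -lt0n.
- move=> /(natdivs_notin_between _ _ halpha0 halpha1 _ n0)[k hk].
  split=> [|x]; first exact: sign_changing_quantile_psi.
  by exists (sort <=%R x)`_k; exact: is_vartheta_nth_sort.
move=> /(natdivs_notin_between _ _ halpha0 halpha1 _ n0)[k hk] x.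
have [kna nak] := andP hk.
have ceilE : Num.ceil (n%:R * alpha) = k.+1.
  by apply: ceil_def; rewrite -addn1 PoszD addrK -PoszD addn1 -!pmulrn kna ltW.
have floorE : Num.floor (n%:R * alpha + 1) = k.+1.
  apply: floor_def; rewrite -PoszD addn1 -!pmulrn.
  by move: kna nak; rewrite -!natr1 => kna nak; apply/andP; split; lra.
have statE : order_stat x k.+1 = (sort <=%R x)`_k.
  by rewrite /order_stat -addn1 PoszD addrK.
have hv := is_vartheta_nth_sort _ _ halpha0 halpha1 _ x _ hk.
have varthetaE : vartheta (quantile_psi alpha) x = (sort <=%R x)`_k.
  by apply: (is_vartheta_unique (xgetPex 0 _) hv); exists (sort <=%R x)`_k.
rewrite ceilE floorE statE varthetaE; split=> //; lra.
Qed.
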